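(* Let $G$ be any digraph and let $s_n$ ($n\ge1$) be the associative spectrum of its graph algebra $\mathbb{A}(G)$. Then exactly one of the following three cases occurs: (i) $s_n=1$ for all $n$, i.e. $\mathbb{A}(G)$ satisfies $x_1(x_2x_3)\approx(x_1x_2)x_3$; (ii) $s_n=2$ for all $n\ge3$; this holds if and only if each weakly connected component of $G$ is either associative (its graph algebra satisfies $x_1(x_2x_3)\approx(x_1x_2)x_3$) or a directed bipartite graph with at least one edge, and the latter occurs for at least one component; (iii) in all other cases, $s_n\ge|R_{n-1}|$ for all $n\ge3$, where $|R_{n-1}|=\Theta(\alpha^n)$ and $\alpha\approx1.755$ is the unique positive root of $x^4-x^3-x^2-1$.
   Context: Digraphs $G=(V,E)$ have $E\subseteq V\times V$, loops allowed, possibly infinite. The graph algebra $\mathbb{A}(G)$ is the groupoid on $V\cup\{\infty\}$ ($\infty\notin V$) with $xy=x$ if $x,y\in V$ and $(x,y)\in E$, and $xy=\infty$ otherwise. $B_n$ is the set of bracketings of size $n$: binary terms in which $x_1,\dots,x_n$ each occur exactly once, in this order. The associative spectrum $s_n$ of a groupoid is the number of distinct $n$-ary term operations induced by the bracketings in $B_n$ (always $s_1=s_2=1$). The weakly connected components of $G$ are its induced subgraphs on the vertex sets of connected components of the underlying undirected graph. A directed bipartite graph is a digraph whose vertex set is partitioned as $V_1\cup V_2$ with $E\subseteq V_1\times V_2$. For $n\ge2$, $R_n$ is the set of words of length $n$ over $\{0,1\}$ that do not start with $01$, do not end with $10$, and do not contain $101$ as a factor. $\Theta(\alpha^n)$ means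 bounded between $c_1\alpha^n$ and $c_2\alpha^n$ for some positive constants $c_1,c_2$. *)

(* Defs.v *)
From mathcomp Require Import all_boot all_order all_algebra.
From mathcomp Require Import boolp reals.
Set Implicit Arguments. Unset Strict Implicit. Unset Printing Implicit Defensive.
Import Order.TTheory GRing.Theory Num.Theory.

(* A binary bracketing; its leaves are the variables x_1, ..., x_n in order. *)
Inductive bracketing : Type := BLeaf | BNode of bracketing & bracketing.

Fixpoint bsize (t : bracketing) : nat :=
  match t with BLeaf => 1 | BNode l r => bsize l + bsize r end.

Fixpoint brk_depth (k : nat) : seq bracketing :=
  match k with
  | 0 => [:: BLeaf]
  | k'.+1 => BLeaf :: [seq BNode l r | l <- brk_depth k', r <- brk_depth k']
  end.

(* B_n : every bracketing of size n has depth < n, so this lists all of B_n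
   (possibly with repetitions, which do not affect the count below). *)
Definition brackets (n : nat) : seq bracketing :=
  [seq t <- brk_depth n | bsize t == n].

Fixpoint beval (A : Type) (op : A -> A -> A) (t : bracketing) (f : nat -> A) (k : nat) : A :=
  match t with
  | BLeaf => f k
  | BNode l r => op (beval op l f k) (beval op r f (k + bsize l))
  end.

(* the term operation induced by t (for t of size n only f 0 .. f (n-1) matter,
   so this is the n-ary term operation x_i := f (i-1)) *)
Definition term_op (A : Type) (op : A -> A -> A) (t : bracketing) : (nat -> A) -> A :=
  fun f => beval op t f 0.

Fixpoint nclasses (T : Type) (R : T -> T -> Prop) (s : seq T) : nat :=
  match s with
  | [::] => 0
  | x :: s' => (~~ has (fun y => `[< R x y >]) s') + nclasses R s'
  end.

Definition assoc_spectrum (A : Type) (op : A -> A -> A) (n : nat) : nat :=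
  nclasses (fun t1 t2 => term_op op t1 = term_op op t2) (brackets n).

(* carrier V ∪ {∞}, with None playing the role of ∞ *)
Definition gop (V : Type) (E : rel V) (x y : option V) : option V :=
  match x, y with
  | Some a, Some b => if E a b then Some a else None
  | _, _ => None
  end.

Definition graph_spectrum (V : Type) (E : rel V) (n : nat) : nat :=
  assoc_spectrum (gop E) n.

Definition ga_assoc (V : Type) (E : rel V) : Prop :=
  forall x y z : option V, gop E x (gop E y z) = gop E (gop E x y) z.

Definition dir_bipartite (V : Type) (E : rel V) : Prop :=
  exists P : V -> bool, forall u v, E u v -> P u && ~~ P v.

Definition bip_with_edge (V : Type) (E : rel V) : Prop :=
  dir_bipartite E /\ exists u v, E u v.

Inductive wconn (V : Type) (E : rel V) (u : V) : V -> Prop :=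
  | wc_refl : wconn E u u
  | wc_fwd v w : wconn E u v -> E v w -> wconn E u w
  | wc_bwd v w : wconn E u v -> E w v -> wconn E u w.

Definition wcomp (V : Type) (E : rel V) (v0 : V) : Type := {v : V | wconn E v0 v}.
Definition wcomp_rel (V : Type) (E : rel V) (v0 : V) : rel (wcomp E v0) :=
  fun a b => E (proj1_sig a) (proj1_sig b).

Definition Rword (w : seq bool) : bool :=
  [&& ~~ prefix [:: false; true] w, ~~ suffix [:: true; false] w
    & ~~ infix [:: true; false; true] w].

Definition Rcard (n : nat) : nat := #|[pred w : n.-tuple bool | Rword w]|.

Arguments wcomp_rel {V} E v0 _ _.
Arguments wcomp {V} E v0.

(* Main.v *)
(** A bracketing with leaves 0, ..., n-1 is a rooted tree in preorder: every subterm l r gives an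
edge from the first leaf of l to the first leaf of r. Its value under an assignment of vertices is
the first one if the assignment is a graph homomorphism from that tree to G, and infinity
otherwise; so s_n counts the sets of homomorphisms of such trees into G.

If every component is associative or directed bipartite, only "is it a star?" matters. Otherwise
one of five small induced patterns is present, and each of them separates |R_(n-1)| trees: either
trees of height at most 2, coded by which leaves are children of the root, or caterpillars, coded
by which leaves are childless. In the weakest pattern a colouring only detects the childless
children of the root; in trees of height at most 2 these are marked by the words w such that 1w1
has no factor 101, that is, by R_(n-1). Counting these words with a three-state automaton
gives the growth rate. *)

From HB Require Import structures.
Require Import Defs.
From mathcomp Require Import all_boot all_order all_algebra.
From mathcomp Require Import boolp reals.
From mathcomp Require Import zify ring lra.
Set Implicit Arguments. Unset Strict Implicit. Unset Printing Implicit Defensive.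
Import Order.TTheory GRing.Theory Num.Theory.

(** * Listing bracketings and counting term operations *)

HB.instance Definition _ := gen_eqMixin bracketing.

Lemma bsize_gt0 t : 0 < bsize t.
Proof. by elim: t => //= l hl r _; rewrite addn_gt0 hl. Qed.

Lemma mem_brk_depth t k : bsize t <= k.+1 -> t \in brk_depth k.
Proof.
elim: t k => [|l IHl r IHr] k; first by case: k => [|k] _; rewrite inE eqxx.
have hl := bsize_gt0 l; have hr := bsize_gt0 r.
case: k => [|k] /= h; first by lia.
rewrite inE; apply/orP; right.
by apply: allpairs_f; [apply: IHl|apply: IHr]; lia.
Qed.

Lemma mem_brackets t n : (t \in brackets n) = (bsize t == n).
Proof.
rewrite mem_filter andb_idr // => /eqP <-.
by apply: mem_brk_depth; apply: leqnSn.
Qed.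

(** Like [undup], [nclasses] keeps an element exactly when no later one has the same image;
    [{classic U}] makes equality of operations decidable. *)
Lemma nclassesE (T U : Type) (F : T -> U) (s : seq T) :
  nclasses (fun x y => F x = F y) s = size (undup [seq (F x : {classic U}) | x <- s]).
Proof.
elim: s => //= x s ->.
have -> : has (fun y => `[< F x = F y >]) s =
    ((F x : {classic U}) \in [seq (F y : {classic U}) | y <- s]).
  elim: s => //= y s ->; rewrite inE; congr (_ || _).
pose fs := [seq (F y : {classic U}) | y <- s]; pose b := (F x : {classic U}) \in fs.
rewrite -[LHS]/(~~ b + size (undup fs)).
by rewrite -[RHS]/(size (if b then undup fs else _ :: undup fs)); case: b.
Qed.

(** * Term operations as sets of tree homomorphisms *)

Section Homs.
Variables (V : Type) (E : rel V).

Fixpoint hom (t : bracketing) (g : nat -> V) (k : nat) : bool :=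
  match t with
  | BLeaf => true
  | BNode l r => [&& hom l g k, hom r g (k + bsize l) & E (g k) (g (k + bsize l))]
  end.

Lemma beval_hom t g k :
  beval (gop E) t (fun i => Some (g i)) k = if hom t g k then Some (g k) else None.
Proof.
elim: t k => //= l IHl r IHr k; rewrite IHl IHr.
by case: (hom l g k) => //=; case: (hom r g _).
Qed.

Lemma beval_None t f k i :
  k <= i < k + bsize t -> f i = None -> beval (gop E) t f k = None.
Proof.
move=> + fi; elim: t k => [|l IHl r IHr] k /=.
  by move=> h; have -> : k = i by lia.
move=> h; case: (ltnP i (k + bsize l)) => hi.
  by rewrite IHl //; lia.
by rewrite IHr; [case: (beval _ l _ _)|lia].
Qed.

Lemma beval_eq_in (A : Type) (op : A -> A -> A) t f f' k :
  (forall i, k <= i < k + bsize t -> f i = f' i) ->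
  beval op t f k = beval op t f' k.
Proof.
elim: t k => [|l IHl r IHr] k /= h; first by apply: h; lia.
by rewrite IHl ?IHr // => i hi; apply: h; lia.
Qed.

Lemma eq_hom t t' : term_op (gop E) t = term_op (gop E) t' ->
  forall g, hom t g 0 = hom t' g 0.
Proof.
move=> tt' g; have := congr1 (fun F => F (fun i => Some (g i))) tt'.
by rewrite /term_op !beval_hom; do 2 case: (hom _ g 0).
Qed.

(** If some variable is infinity, both terms are; every other assignment is a vertex assignment on
    the leaves. *)
Lemma eq_term_op t t' : bsize t = bsize t' ->
  (forall g, hom t g 0 = hom t' g 0) -> term_op (gop E) t = term_op (gop E) t'.
Proof.
move=> st ht; apply/funext => f; rewrite /term_op.
have [/allP hf|/allPn[i]] := boolP (all (fun i => f i : bool) (iota 0 (bsize t))); last first.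
  rewrite mem_iota => hi; case fi: (f i) => // _.
  by rewrite (@beval_None t f 0 i) // (@beval_None t' f 0 i) // -st.
have := hf 0; rewrite mem_iota bsize_gt0 => /(_ isT).
case: (f 0) => // d _.
(* Beyond the leaves [f] may still be infinity; the vertex [d] replaces it there. *)
have fE i : 0 <= i < 0 + bsize t -> f i = Some (odflt d (f i)).
  by move=> hi; have := hf i; rewrite mem_iota hi => /(_ isT); case: (f i).
rewrite (beval_eq_in _ fE) (@beval_eq_in _ _ t' f (fun i => Some (odflt d (f i)))); last first.
  by move=> i hi; apply: fE; rewrite st.
by rewrite !beval_hom ht.
Qed.

Lemma wconn_hom t g k i : hom t g k -> k <= i < k + bsize t -> wconn E (g k) (g i).
Proof.
have tr u v w : wconn E u v -> wconn E v w -> wconn E u w.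
  move=> uv; elim=> // [a b _ h ab|a b _ h ab]; first exact: wc_fwd ab.
  exact: wc_bwd ab.
elim: t k => [|l IHl r IHr] k /=.
  by move=> _ h; suff -> : i = k by [exact: wc_refl|]; lia.
case/and3P => hl hr e h; case: (ltnP i (k + bsize l)) => hi.
  by apply: IHl => //; lia.
apply: (@tr _ (g (k + bsize l))); last by apply: IHr => //; lia.
by apply: wc_fwd e; exact: wc_refl.
Qed.

Definition star_edges (g : nat -> V) k n := all (fun i => E (g k) (g i)) (iota k.+1 n.-1).

Lemma star_edges_cat g k m n : 0 < m -> 0 < n ->
  star_edges g k (m + n) = [&& star_edges g k m, E (g k) (g (k + m)) &
    all (fun i => E (g k) (g i)) (iota (k + m).+1 n.-1)].
Proof.
case: m => // m _; case: n => // n _; rewrite /star_edges addSn /= iotaD all_cat /=.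
by rewrite addSnnS addnS.
Qed.

(** When both ends of an edge have the same out-neighbours, the children of a node can be moved up
    to its parent until the tree is a star. The set [C] allows restriction to one component. *)
Lemma hom_assoc (C : V -> Prop) :
  (forall x y z, C x -> C y -> C z -> E x y -> E y z = E x z) ->
  forall t g k, (forall i, k <= i < k + bsize t -> C (g i)) ->
  hom t g k = star_edges g k (bsize t).
Proof.
move=> asC; elim=> [|l IHl r IHr] g k hC //=.
have sl := bsize_gt0 l; have sr := bsize_gt0 r.
rewrite IHl; last by move=> i hi; apply: hC => /=; lia.
rewrite IHr; last by move=> i hi; apply: hC => /=; lia.
rewrite star_edges_cat //; case: (star_edges g k _) => //=.
rewrite [RHS]andbC; have [e|] := boolP (E (g k) _); rewrite ?andbF // !andbT.
apply: eq_in_all => i; rewrite mem_iota => hi.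
by apply: asC => //; apply: hC => /=; lia.
Qed.

Fixpoint isstar t := match t with
  | BLeaf => true
  | BNode l BLeaf => isstar l
  | _ => false end.

Lemma hom_star t g k : isstar t -> hom t g k = star_edges g k (bsize t).
Proof.
elim: t k => // l IHl [|//] _ k /= h.
by rewrite IHl // star_edges_cat ?bsize_gt0 //= !andbT.
Qed.

(** A tree other than a star has a node at depth two; a directed bipartite graph contains no such
    path. *)
Lemma hom_path2 t g k : ~~ isstar t -> hom t g k ->
  exists i j, [/\ k <= i < k + bsize t, k <= j < k + bsize t, E (g k) (g i) & E (g i) (g j)].
Proof.
elim: t k => // l IHl r _ k /=; case: r => [|r1 r2] /=.
  move=> ns /andP[hl _]; have [i [j [hi hj e1 e2]]] := IHl k ns hl.
  by exists i, j; split => //; lia.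
move=> _ /and3P[_ /and3P[_ _ e2] e1].
have := bsize_gt0 l; have := bsize_gt0 r1; have := bsize_gt0 r2 => *.
by exists (k + bsize l), (k + bsize l + bsize r1); split => //; lia.
Qed.

End Homs.

(** * Spectra one and two *)

Fixpoint comb n := if n is n'.+1 then BNode (comb n') BLeaf else BLeaf.

Lemma bsize_comb n : bsize (comb n) = n.+1.
Proof. by elim: n => //= n ->; rewrite addn1. Qed.

Lemma isstar_comb n : isstar (comb n).
Proof. by elim: n. Qed.

Lemma ga_assocP (V : Type) (E : rel V) :
  ga_assoc E <-> forall u v w, E u v -> E v w = E u w.
Proof.
split=> [h u v w uv|h [x|] [y|] [z|] //=].
- have := h (Some u) (Some v) (Some w); rewrite /= uv.
  by case: (E v w) => /=; rewrite ?uv; case: (E u w).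
- case: (boolP (E x y)) => xy /=; first by rewrite (h _ _ _ xy); case: (E x z) => //=; rewrite xy.
  by case: (E y z) => //=; rewrite (negbTE xy).
- by case: (E x y).
Qed.

Lemma spectrum_assoc (V : Type) (E : rel V) : ga_assoc E ->
  forall n, 0 < n -> graph_spectrum E n = 1.
Proof.
move=> /ga_assocP asE [//|n] _; rewrite /graph_spectrum /assoc_spectrum nclassesE.
set s := map _ _; pose a : {classic _} := term_op (gop E) (comb n).
have sa x : (x \in s) = (x \in [:: a]).
  rewrite inE; apply/mapP/eqP => [[t]|->]; last first.
    by exists (comb n) => //; rewrite mem_brackets bsize_comb.
  rewrite mem_brackets => /eqP st ->; apply: eq_term_op; rewrite ?bsize_comb // => g.
  by rewrite !(@hom_assoc V E (fun=> True)) ?bsize_comb ?st // => *; exact: asE.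
apply: (@perm_size _ _ [:: a]); apply: uniq_perm; rewrite ?undup_uniq //.
by move=> x; rewrite mem_undup sa.
Qed.

Lemma assoc_of_spectrum (V : Type) (E : rel V) : graph_spectrum E 3 = 1 -> ga_assoc E.
Proof.
rewrite /graph_spectrum /assoc_spectrum nclassesE.
set s := map _ _ => s1 x y z.
pose a : {classic _} := term_op (gop E) (BNode BLeaf (BNode BLeaf BLeaf)).
pose b : {classic _} := term_op (gop E) (BNode (BNode BLeaf BLeaf) BLeaf).
have ia : a \in undup s by rewrite mem_undup map_f // mem_brackets.
have ib : b \in undup s by rewrite mem_undup map_f // mem_brackets.
have ab : a = b.
  by case: (undup s) s1 ia ib => [|c []] // _; rewrite !inE => /eqP -> /eqP ->.
by have := congr1 (fun F => F (nth x [:: x; y; z])) ab.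
Qed.

(** One operation comes from the star, the other from all remaining trees: these agree on
    associative components and have no homomorphism into bipartite ones. *)
Lemma spectrum_two (V : Type) (E : rel V) :
  (forall v0 : V, ga_assoc (wcomp_rel E v0) \/ bip_with_edge (wcomp_rel E v0)) ->
  (exists v0 : V, bip_with_edge (wcomp_rel E v0)) ->
  forall n, 2 < n -> graph_spectrum E n = 2.
Proof.
move=> hE [v0 [[P hP] [[u cu] [[v cv] uv]]]] [|[|[|n]]] // _.
rewrite /wcomp_rel /= in uv.
rewrite /graph_spectrum /assoc_spectrum nclassesE.
set s := map _ _; pose a : {classic _} := term_op (gop E) (comb n.+2).
pose t1 := BNode (comb n) (BNode BLeaf BLeaf).
have st1 : bsize t1 = n.+3 by rewrite /= bsize_comb; lia.
pose b : {classic _} := term_op (gop E) t1.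
have sab x : (x \in s) = (x \in [:: a; b]).
  rewrite !inE; apply/mapP/orP => [[t]|]; last first.
    case=> /eqP ->; first by exists (comb n.+2) => //; rewrite mem_brackets bsize_comb.
    by exists t1 => //; rewrite mem_brackets st1.
  rewrite mem_brackets => /eqP st ->; have [tst|tst] := boolP (isstar t); [left|right]; apply/eqP.
    apply: eq_term_op; rewrite ?bsize_comb // => g.
    by rewrite !hom_star ?isstar_comb // bsize_comb st.
  apply: eq_term_op => [|g]; rewrite ?st1 //.
  (* A homomorphism never leaves the component of the image of the root. *)
  have [hw|hw] := pselect (forall i, i < n.+3 -> wconn E (g 0) (g i)); last first.
    transitivity false; last apply/esym; apply/negP => h; apply: hw => i hi.
      by apply: (wconn_hom h); rewrite st.
    by apply: (wconn_hom h); rewrite st1.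
  case: (hE (g 0)) => [/ga_assocP as0|[[Q hQ] _]].
    rewrite !(@hom_assoc V E (wconn E (g 0))) ?st1 ?st //.
      by move=> x1 y1 z1 cx cy cz; exact: (as0 (exist _ x1 cx) (exist _ y1 cy) (exist _ z1 cz)).
    by move=> x1 y1 z1 cx cy cz; exact: (as0 (exist _ x1 cx) (exist _ y1 cy) (exist _ z1 cz)).
  have no t' : bsize t' = n.+3 -> ~~ isstar t' -> hom E t' g 0 = false.
    move=> st' ns; apply/negP => /(hom_path2 ns)[i [j []]]; rewrite st' => hi hj e1 e2.
    have ci := hw i hi; have cj := hw j hj.
    have /andP[_] := hQ (exist _ (g 0) (wc_refl E (g 0))) (exist _ (g i) ci) e1.
    by have /andP[->] := hQ (exist _ (g i) ci) (exist _ (g j) cj) e2.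
  by rewrite !no.
have nab : a <> b.
  (* With the root at the tail of an edge and all other leaves at its head, the star is accepted and
     [t1] is not. *)
  move=> ab; have := eq_hom ab (fun i => if i is 0 then u else v).
  rewrite hom_star ?isstar_comb // /star_edges => hab.
  suff : hom E t1 (fun i => if i is 0 then u else v) 0.
    case/hom_path2 => // -[|i] [[|j] []] // _ _ e1 e2.
    - have := hP (exist _ u cu) (exist _ u cu) e1; by rewrite andbN.
    - have := hP (exist _ u cu) (exist _ u cu) e1; by rewrite andbN.
    - have /andP[_] := hP (exist _ u cu) (exist _ v cv) e1.
      by have /andP[->] := hP (exist _ v cv) (exist _ u cu) e2.
    - have := hP (exist _ v cv) (exist _ v cv) e2; by rewrite andbN.
  rewrite -hab; apply/allP => -[|i]; rewrite mem_iota //.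
apply: (@perm_size _ _ [:: a; b]); apply: uniq_perm; rewrite ?undup_uniq //.
  by rewrite /= inE andbT; apply/eqP.
by move=> x; rewrite mem_undup sab.
Qed.

(** * R-words as codes of trees *)

(* No factor 101 in the word [:: p, q & w ++ [:: true]]. *)
Fixpoint no101 (p q : bool) (w : seq bool) : bool :=
  if w is x :: w' then ~~ [&& p, ~~ q & x] && no101 q x w' else ~~ (p && ~~ q).

Lemma no101_true p w : no101 p true w = no101 true true w.
Proof. by case: w p => [|x w] []. Qed.

(** A factor 101 of the padded word starts at [p], starts at [q], lies inside [w], or ends at the
    final 1. *)
Lemma no101E p q w : no101 p q w =
  [&& ~~ (p && ~~ q && prefix [:: true] w), ~~ (q && prefix [:: false; true] w),
      ~~ infix [:: true; false; true] w & ~~ suffix [:: true; false] [:: p, q & w]].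
Proof.
elim: w p q => [|x w IH] p q; first by case: p q => [] [].
rewrite [LHS]/= IH.
have -> : suffix [:: true; false] [:: p, q, x & w] = suffix [:: true; false] [:: q, x & w].
  by rewrite !suffixE /= !subSS !subn0.
case: (suffix _ _); rewrite ?andbF // !andbT.
by case: w {IH} => [|y [|z w]] /=; case: p; case: q; case: x; try case: y; try case: z;
  rewrite /= ?prefix0s ?andbF ?andbT ?orbF.
Qed.

(** Padding with ones turns the conditions on both ends into the absence of 101. The one-letter word
    0 would be an exception. *)
Lemma Rword_no101 w : 1 < size w -> Rword w = no101 true true w.
Proof.
case: w => [|x [|y w]] // _; rewrite no101E /Rword /=.
have -> : suffix [:: true; false] [:: true, true, x, y & w] = suffix [:: true; false] [:: x, y & w].
  by rewrite !suffixE /= !subSS !subn0.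
by rewrite [in RHS]andbA [in RHS]andbC; case: (suffix _ _); rewrite ?andbF ?andbT.
Qed.

(** A leaf has to be a root child if it is marked, or if the leaf before it is marked and so must
    stay childless; no further root children are chosen. *)
Fixpoint bits (x : bool) (w : seq bool) : seq bool :=
  if w is y :: w' then (x || y) :: bits y w' else [::].

Lemma size_bits x w : size (bits x w) = size w.
Proof. by elim: w x => //= y w IH x; rewrite IH. Qed.

(* In the tree coded by s (see [flat]), marks the leaves from number 1 on that are childless
   children of the root; q tells whether the first of them is a child of the root. *)
Fixpoint leaves (q : bool) (s : seq bool) : seq bool :=
  if s is x :: s' then (q && x) :: leaves x s' else [:: q].

Definition leaves_tail (s : seq bool) := if s is x :: s' then leaves x s' else [::].

Lemma leavesE q s : leaves q s = (q && head true s) :: leaves_tail s.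
Proof. by case: s => //=; rewrite andbT. Qed.

Lemma size_leaves q s : size (leaves q s) = (size s).+1.
Proof. by elim: s q => //= x s IH q; rewrite IH. Qed.

(* The R-word [x :: w] is realised as the set of childless root children of the tree whose root
   children are coded by [bits x w]. *)
Lemma bitsK p x w : no101 p x w -> leaves (p || x) (bits x w) = x :: w.
Proof.
elim: w p x => [|y w IH] p x /=; first by case: p x => [] [].
by case/andP => h /IH ->; case: p x y h => [] [] [].
Qed.

Definition Rcard_le (V : Type) (E : rel V) :=
  forall n, 2 < n -> Rcard n.-1 <= graph_spectrum E n.

(** By [bitsK] every R-word is some [leaves true s], so the R-words inject into the term operations
    as soon as homomorphisms determine [leaves true s]. *)
Lemma Rcard_le_of_separating (V : Type) (E : rel V) (T : seq bool -> bracketing) :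
  (forall s, bsize (T s) = (size s).+2) ->
  (forall s s', size s = size s' -> (forall g, hom E (T s) g 0 = hom E (T s') g 0) ->
    leaves true s = leaves true s') ->
  Rcard_le E.
Proof.
move=> sT inj [|[|[|n]]] // _; rewrite /Rcard /graph_spectrum /assoc_spectrum nclassesE /=.
set s := map _ _; pose f (w : n.+2.-tuple bool) := bits (head true w) (behead w).
have sf w : size (f w) = n.+1 by rewrite size_bits size_behead size_tuple.
have fK (w : n.+2.-tuple bool) : Rword w -> leaves true (f w) = w.
  case: w => [[|x w] //= sw]; rewrite /f /= => hw.
  have : no101 true x w; last by move/bitsK.
  move: hw; rewrite Rword_no101 /=; last by move: sw; rewrite /= eqSS => /eqP ->.
  by [].
pose F w : {classic _} := term_op (gop E) (T (f w)).
rewrite cardE -(size_map F); apply: uniq_leq_size.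
  rewrite map_inj_in_uniq ?enum_uniq // => w w'; rewrite !mem_enum !inE => hw hw' /eq_hom h.
  by apply: val_inj; rewrite /= -fK // -[RHS]fK //; apply: inj => //; rewrite !sf.
move=> _ /mapP[w _ ->]; rewrite mem_undup.
apply: (map_f (fun t => (term_op (gop E) t : {classic _}))).
by rewrite mem_brackets sT sf.
Qed.

Lemma all2_implyb_anti s s' : all2 implb s s' -> all2 implb s' s -> s = s'.
Proof.
elim: s s' => [|x s IH] [|x' s'] //= /andP[h1 /IH h] /andP[h2 /h ->].
by case: x x' h1 h2 => [] [].
Qed.

(* In [flat BLeaf BLeaf s] the leaf 0 is the root of the tree, leaf 1 is a child of the root,
   and bit i of s tells whether leaf i.+2 is a child of the root or of the last root child. *)
Fixpoint flat (acc blk : bracketing) (s : seq bool) : bracketing :=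
  match s with
  | [::] => BNode acc blk
  | true :: s' => flat (BNode acc blk) BLeaf s'
  | false :: s' => flat acc (BNode blk BLeaf) s'
  end.

Lemma bsize_flat acc blk s : bsize (flat acc blk s) = bsize acc + bsize blk + size s.
Proof. by elim: s acc blk => [|[] s IH] acc blk /=; rewrite ?addn0 // IH /=; lia. Qed.

(* In [cater BLeaf s] the parent of every leaf is the last inner node before it, and bit i
   of s tells whether leaf i.+1 has no child. *)
Fixpoint cater (acc : bracketing) (s : seq bool) : bracketing :=
  match s with
  | [::] => BNode acc BLeaf
  | true :: s' => cater (BNode acc BLeaf) s'
  | false :: s' => BNode acc (cater BLeaf s')
  end.

Lemma bsize_cater acc s : bsize (cater acc s) = bsize acc + (size s).+1.
Proof. by elim: s acc => [|[] s IH] acc //=; rewrite IH /=; lia. Qed.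

(** * The five patterns and their separating colourings *)

Section Patterns.
Variables (V : Type) (E : rel V).

(** [r] and [q] are the colours of the root and of the last root child, [cs] those of the leaves to
    come. *)
Fixpoint flat_ok (r q : V) (s : seq bool) (cs : seq V) : bool :=
  match s, cs with
  | x :: s', c :: cs' => E (if x then r else q) c && flat_ok r (if x then c else q) s' cs'
  | _, _ => true
  end.

Lemma hom_flat acc blk s g k : hom E (flat acc blk s) g k =
  [&& hom E acc g k, hom E blk g (k + bsize acc), E (g k) (g (k + bsize acc)) &
    flat_ok (g k) (g (k + bsize acc)) s
      [seq g i | i <- iota (k + bsize acc + bsize blk) (size s)]].
Proof.
elim: s acc blk => [|[] s IH] acc blk /=; first by rewrite andbT.
  by rewrite IH /= !addnA addn1 -!andbA.
rewrite IH /= addnA addn1 -!andbA; case: (hom E acc _ _) => //=; case: (hom E blk _ _) => //=.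
by rewrite andbCA.
Qed.

(** [q] is the colour of the last inner node. The final leaf has no bit and is childless, hence the
    default [true]. *)
Fixpoint cater_ok (q : V) (s : seq bool) (cs : seq V) : bool :=
  if cs is c :: cs' then E q c && cater_ok (if head true s then q else c) (behead s) cs'
  else true.

Lemma hom_cater acc s g k : hom E (cater acc s) g k =
  hom E acc g k && cater_ok (g k) s [seq g i | i <- iota (k + bsize acc) (size s).+1].
Proof.
elim: s acc k => [|[] s IH] acc k.
- by rewrite /= andbT.
- by rewrite [cater _ _]/= IH /= addnA addn1 -!andbA.
by rewrite /= IH /= addn1; case: (hom E acc _ _) => //=; rewrite andbC.
Qed.

Lemma nth_iota_map (d : V) cs c0 k : [seq nth d (c0 ++ cs) i | i <- iota (size c0) k] =
  [seq nth d cs i | i <- iota 0 k].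
Proof.
rewrite -[size c0]addn0 iotaDl -map_comp; apply: eq_map => i /=.
by rewrite nth_cat ltnNge leq_addr addKn.
Qed.

Lemma Rcard_le_flat :
  (forall s s', size s = size s' ->
    (forall u c cs, size cs = size s -> E u c -> flat_ok u c s cs = flat_ok u c s' cs) ->
    leaves true s = leaves true s') -> Rcard_le E.
Proof.
move=> H; apply: (@Rcard_le_of_separating _ _ (flat BLeaf BLeaf)) => [s|s s' ss h].
  by rewrite bsize_flat.
apply: H => // u c cs sc uc; have := h (nth u [:: u, c & cs]).
rewrite !hom_flat /= uc -ss /= !(nth_iota_map u cs [:: u; c]).
by rewrite -sc -/(mkseq _ _) mkseq_nth.
Qed.

(** Colour the root [u], its children [v] and the grandchildren [w]. Another tree accepting this
    colouring cannot have a leaf coloured [w] as a root child. *)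
Lemma Rcard_le_nontransitive u v w : E u v -> E v w -> ~~ E u w -> Rcard_le E.
Proof.
move=> uv vw uw; pose col b := if b then v else w.
have own s : flat_ok u v s (map col s).
  by elim: s => //= -[] s IH; rewrite /= ?uv ?vw.
have other q s s' : size s = size s' -> flat_ok u q s' (map col s) -> all2 implb s' s.
  elim: s s' q => [|x s IH] [|x' s'] q //= [ss] /andP[e /(IH _ _ ss) ->].
  by case: x' x e => [] [] //=; rewrite (negbTE uw).
apply: Rcard_le_flat => s s' ss h; congr leaves; apply: all2_implyb_anti.
  by apply: (@other v) => //; rewrite h ?size_map // -?ss.
by apply: (@other v) => //; rewrite -h ?size_map.
Qed.

(** Same colouring, opposite inclusion: neither [v] nor [w] has an edge to [v], so leaves coloured
    [v] must be root children. *)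
Lemma Rcard_le_loopless_middle u v w : E u v -> E v w -> E u w -> ~~ E v v -> ~~ E w v -> Rcard_le E.
Proof.
move=> uv vw uw vv wv; pose col b := if b then v else w.
have own s : flat_ok u v s (map col s).
  by elim: s => //= -[] s IH; rewrite /= ?uv ?vw.
have other q s s' : size s = size s' -> ~~ E q v -> flat_ok u q s' (map col s) -> all2 implb s s'.
  elim: s s' q => [|x s IH] [|x' s'] q //= [ss] qv /andP[e /(IH _ _ ss) ->].
    by rewrite andbT; case: x' x e => [] [] //=; rewrite (negbTE qv).
  by case: (x') x {e} => [] [].
apply: Rcard_le_flat => s s' ss h; congr leaves; apply: all2_implyb_anti.
  by apply: (@other v) => //; rewrite -h ?size_map.
by apply: (@other v) => //; rewrite h ?size_map // -?ss.
Qed.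

(** Switching from [v] to [w] at one leaf tests a single bit: the leaf cannot hang below [v], so it
    must be a root child. *)
Lemma Rcard_le_two_loops u v w :
  E u v -> E u w -> E v v -> E w w -> ~~ E v w -> Rcard_le E.
Proof.
move=> uv uw vv ww vw.
have cst s k : flat_ok u w s (nseq k w).
  by elim: s k => [|x s IH] [|k] //=; case: x; rewrite ?uw ?ww IH.
have key s p : p < size s -> flat_ok u v s (nseq p v ++ nseq (size s - p) w) = nth true s p.
  elim: s p => [|x s IH] [|p] //= hp.
    by case: x; rewrite ?(negbTE vw) //= uw cst.
  by rewrite subSS; case: x; rewrite ?uv ?vv IH.
apply: Rcard_le_flat => s s' ss h; congr leaves; apply: (@eq_from_nth _ true) => // i hi.
rewrite -!key -?ss //; apply: h => //; rewrite size_cat !size_nseq; lia.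
Qed.

(** Colour [w] the childless root children and [v] all other non-root leaves. Since [w] has no edge
    to or from [v] and itself, any tree accepting this has the leaves coloured [w] among its own
    childless root children. *)
Lemma Rcard_le_loop_leaf u v w :
  E u v -> E v v -> E u w -> ~~ E w v -> ~~ E v w -> ~~ E w w -> Rcard_le E.
Proof.
move=> uv vv uw wv vw ww; pose col b := if b then w else v.
have ucol b : E u (col b) by case: b.
have own q s : flat_ok u (col (q && head true s)) s (map col (leaves_tail s)).
  elim: s q => [|x s IH] q //=; rewrite leavesE /=.
  by case: x => /=; rewrite ?ucol ?andbF ?vv /= ?(IH true) ?(IH false).
(* [q] and [q'] tell whether the current leaf is a root child in the two trees; [c] is the colour of
   the last root child in the second. *)
have other s s' q q' c : size s = size s' -> q && head true s ==> q' ->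
    (q' -> c = col (q && head true s)) -> ~~ E c w ->
    flat_ok u c s' (map col (leaves_tail s)) -> all2 implb (leaves q s) (leaves q' s').
  elim: s s' q q' c => [|x s IH] [|x' s'] q q' c //=; first by rewrite andbT => _ ->.
  move=> [ss] aq' cE cw; rewrite {1}[leaves x s]leavesE => /andP[e h].
  apply/andP; split.
    apply/implyP => a; have q't : q' by move: aq'; rewrite a.
    rewrite q't; case: x' e {h} => //=; rewrite cE // a /= => e.
    by move: e; case: (x && _); rewrite /col ?(negbTE wv) ?(negbTE ww).
  apply: (IH _ _ _ (if x' then col (x && head true s) else c)) => //.
  - by apply/implyP => b; case: x' e {h} => //; rewrite b (negbTE cw).
  - by case: x' {e h}.
  - by case: x' {e h} => //; case: (x && _).
apply: Rcard_le_flat => s s' ss h.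
have sl t : size (map col (leaves_tail t)) = size t.
  by rewrite size_map; case: t => //= x t; rewrite size_leaves.
apply: all2_implyb_anti.
  apply: (@other _ _ _ _ (col (head true s))); rewrite ?implybT //.
    by case: (head true s).
  by rewrite -h //; apply: (own true).
apply: (@other _ _ _ _ (col (head true s'))); rewrite ?implybT //.
  by case: (head true s').
by rewrite h ?sl // ; apply: (own true).
Qed.

(** In caterpillars, colour inner nodes [a] and childless ones [b]: a leaf coloured [b] can have no
    child in any tree accepting this. *)
Lemma Rcard_le_loop_sink a b : E a a -> E a b -> ~~ E b a -> ~~ E b b -> Rcard_le E.
Proof.
move=> aa ab ba bb; pose col x := if x then b else a.
have own s : cater_ok a s (rcons (map col s) b).
  by elim: s => [|[] s IH] /=; rewrite ?ab ?aa.
have bcol x : E b (col x) = false by case: x; apply/negbTE.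
have other s s' : size s = size s' -> cater_ok a s' (rcons (map col s) b) -> all2 implb s s'.
  elim: s s' => [|x s IH] [|x' s'] //= [ss] /andP[_].
  case: x x' => [] [] /= h; try exact: (IH _ ss).
  by case: s ss h {IH} => [|y s] /= _; rewrite ?bcol // (negbTE bb).
apply: (@Rcard_le_of_separating _ _ (cater BLeaf)) => [s|s s' ss h].
  by rewrite bsize_cater.
have {}h cs : size cs = (size s).+1 -> cater_ok a s cs = cater_ok a s' cs.
  move=> sc; have := h (nth a (a :: cs)).
  by rewrite !hom_cater -ss -sc !(nth_iota_map a cs [:: a]) -/(mkseq _ _) mkseq_nth.
congr leaves; apply: all2_implyb_anti.
  by apply: other => //; rewrite -h // size_rcons size_map.
by apply: other => //; rewrite h // size_rcons size_map ss.
Qed.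

(* A vertex is near a loop when it or one of its out-neighbours carries a loop; without the
   five patterns this property is constant on weakly connected components. *)
Lemma components_tame : ~ Rcard_le E ->
  forall v0 : V, ga_assoc (wcomp_rel E v0) \/ bip_with_edge (wcomp_rel E v0).
Proof.
move=> noR v0.
(* Each excluded pattern becomes a closure property of [E]. *)
have tr u v w : E u v -> E v w -> E u w.
  by move=> uv vw; apply: contraT => uw; case: noR; exact: Rcard_le_nontransitive uv vw uw.
have loop u v w : E u v -> E v w -> E v v.
  move=> uv vw; apply: contraT => vv; case: noR.
  apply: (Rcard_le_loopless_middle uv vw (tr _ _ _ uv vw) vv).
  by apply: contra vv => /(tr _ _ _ vw).
have loops u v w : E u v -> E u w -> E v v -> E w w -> E v w.
  by move=> *; apply: contraT => ?; case: noR; apply: (@Rcard_le_two_loops u v w).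
have sink a b : E a a -> E a b -> E b b.
  move=> aa ab; apply: contraT => bb; case: noR.
  apply: (Rcard_le_loop_sink aa ab) => //; apply: contra bb => ba; exact: tr ba ab.
have leaf u v w : E u v -> E v v -> E u w -> E w w.
  move=> uv vv uw; apply: contraT => ww; case: noR.
  have vw : ~~ E v w by apply: contra ww; exact: sink.
  apply: (Rcard_le_loop_leaf uv vv uw) => //; apply: contra ww => wv; exact: loop uw wv.
pose near u := exists2 v, u = v \/ E u v & E v v.
have nearR x y : E x y -> near x -> E y y.
  by move=> xy [v [<-|xv] vv]; [exact: sink vv xy|exact: leaf xv vv xy].
have near_edge x y : E x y -> near x <-> near y.
  move=> xy; split=> [nx|[v [<-|yv] vv]].
  - by exists y; [left|exact: nearR nx].
  - by exists y; [right|].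
  - by exists v => //; right; exact: tr yv.
have near_comp x : wconn E v0 x -> near v0 <-> near x.
  by elim=> // y z _ IH e; rewrite IH; [|symmetry]; exact: near_edge.
have [nv0|fv0] := pselect (near v0).
  (* Every edge of this component ends in a loop, so [tr] and [loops] give the two halves of
     associativity. *)
  left; apply/ga_assocP => -[u cu] [v cv] [w cw]; rewrite /wcomp_rel /= => uv.
  have nu : near u by case: (near_comp _ cu) => nu _; exact: nu.
  have vv := nearR _ _ uv nu; apply/idP/idP => [|uw]; first exact: tr.
  exact: loops uv uw vv (nearR _ _ uw nu).
have [ed|ned] := pselect (exists u v, wcomp_rel E v0 u v); [right|left].
  (* Two consecutive edges would force a loop at their middle vertex, so the vertices with an
     out-neighbour form one side. *)
  split=> //; exists (fun x => `[< exists y, wcomp_rel E v0 x y >]) => u v uv.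
  apply/andP; split; first by apply/asboolP; exists v.
  apply/asboolPn => -[w vw]; apply: fv0; apply/(near_comp _ (proj2_sig v)).
  by exists (proj1_sig v); [left|exact: loop uv vw].
by apply/ga_assocP => u v w uv; case: ned; exists u, v.
Qed.

End Patterns.

(** * Counting R-words and their growth rate *)

Fixpoint words (n : nat) : seq (seq bool) :=
  if n is n'.+1 then map (cons true) (words n') ++ map (cons false) (words n') else [:: [::]].

Lemma mem_words n w : (w \in words n) = (size w == n).
Proof.
elim: n w => [|n IH] [|x w] //=; rewrite mem_cat.
  by apply/norP; split; apply/mapP => -[].
have memc (y : bool) : (x :: w \in map (cons y) (words n)) = (x == y) && (w \in words n).
  apply/mapP/andP => [[u hu [xy ->]]|[/eqP <- hw]]; first by rewrite xy eqxx.
  by exists w.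
by rewrite !memc IH eqSS; case: (x) => /=; rewrite ?orbF.
Qed.

Lemma uniq_words n : uniq (words n).
Proof.
elim: n => //= n IH; rewrite cat_uniq !map_inj_uniq ?IH /= ?andbT; try by move=> u v [].
by apply/hasPn => _ /mapP[w _ ->]; apply/mapP => -[].
Qed.

Lemma card_tuple_words n (P : pred (seq bool)) :
  #|[pred w : n.-tuple bool | P w]| = count P (words n).
Proof.
rewrite cardE -(size_map val) -size_filter; apply/perm_size/uniq_perm.
- by rewrite (map_inj_uniq val_inj) enum_uniq.
- by rewrite filter_uniq ?uniq_words.
move=> w; rewrite mem_filter mem_words; apply/mapP/andP => [[t]|[hw sw]].
  by rewrite mem_enum inE => ht ->; rewrite /= ht size_tuple.
by exists (Tuple sw); rewrite // mem_enum inE.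
Qed.

Definition count_no101 p q n := count (no101 p q) (words n).

Lemma Rcard_no101 n : 1 < n -> Rcard n = count_no101 true true n.
Proof.
move=> n1; rewrite /Rcard card_tuple_words; apply: eq_in_count => w.
by rewrite mem_words => /eqP sw; rewrite Rword_no101 // sw.
Qed.

(** After a letter 1 the letter before it is irrelevant, which leaves three states. *)
Lemma count_no101S p q n : count_no101 p q n.+1 =
  (if p && ~~ q then 0 else count_no101 true true n) + count_no101 q false n.
Proof.
rewrite /count_no101 /= count_cat !count_map; congr (_ + _); last first.
  by apply: eq_count => w /=; rewrite !andbF.
case: ifP => h.
  by rewrite -(count_pred0 (words n)); apply: eq_count => w /=; case/andP: h => -> ->.
by apply: eq_count => w /=; rewrite andbT h /=; case: q h => // _; exact: no101_true.
Qed.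

Local Open Scope ring_scope.

(* The transfer matrix of the automaton has the Perron eigenvector
   (1, alpha - 1, alpha * (alpha - 1)). *)
Lemma count_no101_le (R : realType) (alpha : R) n :
  175 / 100 < alpha -> alpha < 176 / 100 -> alpha * (alpha - 1) ^+ 2 = 1 ->
  [/\ (count_no101 true true n)%:R <= alpha ^+ n,
      (count_no101 true false n)%:R <= (alpha - 1) * alpha ^+ n
    & (count_no101 false false n)%:R <= alpha * (alpha - 1) * alpha ^+ n].
Proof.
move=> alpha_lo alpha_hi alphaE; elim: n => [|n [hA hB hC]].
  by rewrite /count_no101 /= !expr0; split; nra.
rewrite !count_no101S /= add0n !natrD exprS.
split; [nra|nra|].
have -> : alpha * (alpha - 1) * (alpha * alpha ^+ n) =
    alpha * (alpha - 1) ^+ 2 * alpha ^+ n + alpha * (alpha - 1) * alpha ^+ n by ring.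
by rewrite alphaE mul1r; exact: lerD.
Qed.

(** The same eigenvector, from length one on: in state [true false] the empty word is rejected,
    while the eigenvector entry is positive. *)
Lemma count_no101_ge (R : realType) (alpha : R) n :
  175 / 100 < alpha -> alpha < 176 / 100 -> alpha * (alpha - 1) ^+ 2 = 1 ->
  [/\ alpha ^+ n <= (count_no101 true true n.+1)%:R,
      (alpha - 1) * alpha ^+ n <= (count_no101 true false n.+1)%:R
    & alpha * (alpha - 1) * alpha ^+ n <= (count_no101 false false n.+1)%:R].
Proof.
move=> alpha_lo alpha_hi alphaE; elim: n => [|n [hA hB hC]].
  by rewrite /count_no101 /= !expr0; split; nra.
rewrite !(count_no101S _ _ n.+1) /= add0n !natrD exprS.
split; [nra|nra|].
have -> : alpha * (alpha - 1) * (alpha * alpha ^+ n) =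
    alpha * (alpha - 1) ^+ 2 * alpha ^+ n + alpha * (alpha - 1) * alpha ^+ n by ring.
by rewrite alphaE mul1r; exact: lerD.
Qed.

(** As x + 1 has no positive root, only the cubic matters. *)
Lemma quarticE (R : realType) (x : R) :
  x ^+ 4 - x ^+ 3 - x ^+ 2 - 1 = (x + 1) * (x * (x - 1) ^+ 2 - 1).
Proof. by ring. Qed.

Lemma cubic_root (R : realType) :
  exists2 a : R, 175 / 100 < a < 176 / 100 & a * (a - 1) ^+ 2 = 1.
Proof.
pose p : {poly R} := 'X * ('X - 1) ^+ 2 - 1.
have pE x : p.[x] = x * (x - 1) ^+ 2 - 1 by rewrite /p !hornerE.
have [||a /andP[l u]] := @poly_ivt R p (175 / 100) (176 / 100); first by lra.
  by rewrite !pE; apply/andP; split; lra.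
rewrite /root pE subr_eq0 => /eqP aE; exists a => //.
apply/andP; split; rewrite lt_neqAle ?l ?u andbT; apply/eqP => e; move: aE.
  by rewrite -e; lra.
by rewrite e; lra.
Qed.

(** A positive root exceeds 1, and then the cofactor of [x - a] in the difference of the two cubics
    is positive. *)
Lemma cubic_root_uniq (R : realType) (a x : R) : 175 / 100 < a -> a * (a - 1) ^+ 2 = 1 ->
  0 < x -> x * (x - 1) ^+ 2 = 1 -> x = a.
Proof.
move=> a1 aE x0 xE; have x1 : 1 < x by rewrite ltNge; apply/negP => x1; nra.
have : (x - a) * ((x - 1) ^+ 2 + a * (x + a - 2)) = x * (x - 1) ^+ 2 - a * (a - 1) ^+ 2 by ring.
rewrite xE aE subrr => /eqP; rewrite mulf_eq0 subr_eq0 => /orP[/eqP //|/eqP e].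
have : 0 < a * (x + a - 2) by apply: mulr_gt0; lra.
by have := sqr_ge0 (x - 1); lra.
Qed.

Theorem theorem8p6 (R : realType) (V : Type) (E : rel V) :
  let s := graph_spectrum E in
  let case1 := forall n : nat, (0 < n)%N -> s n = 1%N in
  let case2 := forall n : nat, (2 < n)%N -> s n = 2%N in
  [/\ case1 <-> ga_assoc E,
      case2 <->
        ((forall v0 : V, ga_assoc (wcomp_rel E v0) \/ bip_with_edge (wcomp_rel E v0))
         /\ exists v0 : V, bip_with_edge (wcomp_rel E v0)),
      ~ (case1 /\ case2),
      (~ case1 -> ~ case2 -> forall n : nat, (2 < n)%N -> (Rcard n.-1 <= s n)%N)
    & exists alpha c1 c2 : R,
        [/\ (0 < alpha /\ alpha ^+ 4 - alpha ^+ 3 - alpha ^+ 2 - 1 = 0),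
            (forall x : R, 0 < x -> x ^+ 4 - x ^+ 3 - x ^+ 2 - 1 = 0 -> x = alpha),
            175 / 100 < alpha /\ alpha < 176 / 100,
            0 < c1 /\ 0 < c2
          & forall n : nat, (2 < n)%N ->
              c1 * alpha ^+ n <= (Rcard n.-1)%:R /\ (Rcard n.-1)%:R <= c2 * alpha ^+ n]].
Proof.
move=> s case1 case2.
have rich : ~ Rcard_le E -> ga_assoc E \/
    ((forall v0 : V, ga_assoc (wcomp_rel E v0) \/ bip_with_edge (wcomp_rel E v0))
         /\ exists v0 : V, bip_with_edge (wcomp_rel E v0)).
  move=> noR; have tame := components_tame noR.
  (* Without a bipartite component having an edge, all components are associative, and hence so is
     the whole graph. *)
  have [b|nb] := pselect (exists v0 : V, bip_with_edge (wcomp_rel E v0)); [by right|left].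
  apply/ga_assocP => u v w uv; have [as_u|b] := tame u; last by case: nb; exists u.
  have cv : wconn E u v by apply: wc_fwd uv; exact: wc_refl.
  have asE := (ga_assocP _).1 as_u (exist _ u (wc_refl E u)) (exist _ v cv).
  apply/idP/idP => h.
    by have := asE (exist _ w (wc_fwd cv h)) uv; rewrite /wcomp_rel /= h => <-.
  by have := asE (exist _ w (wc_fwd (wc_refl E u) h)) uv; rewrite /wcomp_rel /= h => ->.
have c1 : case1 <-> ga_assoc E.
  split=> [h|]; last exact: spectrum_assoc.
  by apply: assoc_of_spectrum; exact: (h 3%N isT).
have c12 : ~ (case1 /\ case2) by case=> h1 h2; have := h1 3%N isT; rewrite h2.
(* Size 4 is the first to exclude spectrum 2, since R_2 has only the two words 00 and 11. *)
have R3 : Rcard 3 = 4%N by rewrite Rcard_no101.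
have c2 : case2 <-> ((forall v0 : V, ga_assoc (wcomp_rel E v0) \/ bip_with_edge (wcomp_rel E v0))
         /\ exists v0 : V, bip_with_edge (wcomp_rel E v0)).
  split=> [h|[tame b]]; last exact: spectrum_two.
  case: rich => // [hR|as_E].
    by have := hR 4%N isT; rewrite /= R3 -/(s 4%N) h.
  by case: c12; split=> //; exact/c1.
split=> //.
  move=> n1 n2; apply: contrapT => noR; case: rich => // h; first by apply: n1; exact/c1.
  by apply: n2; exact/c2.
have [a /andP[a1 a2] aE] := cubic_root R.
have a0 : 0 < a by lra.
(* For words of length n - 1 the upper bound is the power n - 1 of [a], the lower bound the power n
   - 2. *)
exists a, (a ^- 2), a^-1; split=> //.
- by split=> //; rewrite quarticE aE subrr mulr0.
- move=> x x0 /eqP; rewrite quarticE mulf_eq0 => /orP[/eqP|]; first lra.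
  by rewrite subr_eq0 => /eqP; exact: cubic_root_uniq.
- by rewrite invr_gt0 exprn_gt0 // invr_gt0.
move=> [|[|[|n]]] // _; rewrite Rcard_no101 //=.
have [lo _ _] := count_no101_ge n.+1 a1 a2 aE.
have [hi _ _] := count_no101_le n.+2 a1 a2 aE.
have an0 : a != 0 by rewrite gt_eqF.
split; first by rewrite -[n.+3]/(2 + n.+1)%N exprD mulKf ?expf_neq0.
by rewrite exprS mulKf.
Qed.
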